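(* Let $N_0,N_1\in\mathbb{N}$ be such that $N_1\geqslant2N_0$ and $$\mathcal{A}^{(N_0-k)}=\mathcal{A}^{(N_1-k)},\quad\text{for }0\leqslant k<N_0.$$ Then $\mathbb{V}(\mathbb{G}^{(N_1)}(f))\leqslant\mathbb{V}(\mathbb{G}^{(N_0)}(f))$ for all $f\in\mathcal{F}$, and $\Sigma_m^{(N_0)}-\Sigma_m^{(N_1)}$ is positive semidefinite for all $\{f_1,\dots,f_m\}\subset\mathcal{F}$, where $\Sigma_m^{(N)}=\mathbb{V}((\mathbb{G}^{(N)}(f_1),\dots,\mathbb{G}^{(N)}(f_m)))$.
   Context: $\mathbb{N}=\{0,1,\dots\}$, $\mathbb{N}_*=\{1,2,\dots\}$. $P$ is a probability measure on $(\mathcal{X},\mathcal{A})$, $P(f)=\int f\,dP$. For each $N\in\mathbb{N}_*$, $\mathcal{A}^{(N)}=\{A_1^{(N)},\dots,A_{m_N}^{(N)}\}\subset\mathcal{A}$ is a finite partition of $\mathcal{X}$ with $m_N\geqslant2$ and $\min_jP(A_j^{(N)})>0$; consecutive partitions are different (non-consecutive ones may coincide). $\mathcal{F}$ is a class of measurable real functions, uniformly bounded by $M<\infty$, pointwise measurable (each $f\in\mathcal{F}$ is a pointwise limit of a sequence from a fixed countable subset of $\mathcal{F}$), containing $1_A$ and $1_Af$ for $f\in\mathcal{F}$ and $A$ in the partitions $\mathcal{A}^{(k)}$, $1\leqslant k\leqslant N_1$, and satisfying one of the following entropy conditions, with $d_Q^2(f,g)=\int(f-g)^2dQ$: (VC)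 for some $c_0,\nu_0>0$ the minimal number of $d_Q$-balls of radius $\varepsilon$ covering $\mathcal{F}$ is at most $c_0/\varepsilon^{\nu_0}$ for all $0<\varepsilon<1$ and all discrete probability measures $Q$; (BR) for some $b_0>0,r_0\in(0,1)$ the minimal number of brackets $\{f:g_-\leqslant f\leqslant g_+\}$ with $d_P(g_-,g_+)<\varepsilon$ covering $\mathcal{F}$ is at most $\exp(b_0^2/\varepsilon^{2r_0})$ for $0<\varepsilon<1$. $\mathbb{G}=\mathbb{G}^{(0)}$ is the $P$-Brownian bridge indexed by $\mathcal{F}$: centered Gaussian, linear in $f$, $\mathrm{Cov}(\mathbb{G}(f),\mathbb{G}(g))=P(fg)-P(f)P(g)$. Write $\mathbb{G}^{(N)}(A)=\mathbb{G}^{(N)}(1_A)$ and $\mathbb{E}(f|A)=P(f1_A)/P(A)$. For $N\in\mathbb{N}_*$, $$\mathbb{G}^{(N)}(f)=\mathbb{G}^{(N-1)}(f)-\sum_{j=1}^{m_N}\mathbb{E}(f|A_j^{(N)})\,\mathbb{G}^{(N-1)}(A_j^{(N)}).$$ $\mathbb{V}(\cdot)$ denotes variance or covariance matrix. *)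

(* Defs.v *)
From HB Require Import structures.
From mathcomp Require Export all_boot all_order all_algebra.
From mathcomp Require Export all_classical all_reals all_analysis.

#[global] Set Implicit Arguments.
#[global] Unset Strict Implicit.
#[global] Unset Printing Implicit Defensive.

Export Order.TTheory GRing.Theory Num.Theory.
Export numFieldNormedType.Exports.

#[global] Open Scope classical_set_scope.
#[global] Open Scope ring_scope.

Section partitions.
Context (d : measure_display) (X : measurableType d) (R : realType).
Variable P : probability X R.

(* The N-th partition is (A N j) for j < m N; only the indices N >= 1 are
   meaningful, the data at N = 0 being junk. *)
Definition partition_sequence (m : nat -> nat)
    (A : forall N, 'I_(m N) -> set X) : Prop :=
  (forall N, (1 <= N)%N ->
    [/\ (2 <= m N)%N, partition setT (A N) setT &
        forall j, measurable (A N j) /\ (0 < P (A N j))%E]) /\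
  (forall N, (1 <= N)%N -> range (A N) <> range (A N.+1)).

Definition cond_mean (f : X -> R) (B : set X) : R :=
  (\int[P]_x (f x * \1_B x)) / fine (P B).

End partitions.

Section function_classes.
Context (d : measure_display) (X : measurableType d) (R : realType).
Implicit Types (F : set (X -> R)).

Definition L2dist (Q : probability X R) (f g : X -> R) : \bar R :=
  ('N[Q]_2[EFin \o (f \- g)%R])%E.

(* Countably many atoms; the weights sum to 1 because Q is a probability. *)
Definition discrete_probability (Q : probability X R) : Prop :=
  exists (a : nat -> X) (p : nat -> R), (forall n, 0 <= p n) /\
    forall B, measurable B -> Q B = (\sum_(n <oo) (p n)%:E * \d_(a n) B)%E.

(* The centers of the balls need not belong to F. *)
Definition covered_by_balls (Q : probability X R) (e : R) F (n : nat) : Prop :=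
  exists c : 'I_n -> X -> R, (forall i, measurable_fun setT (c i)) /\
    forall f, F f -> exists i, (L2dist Q (c i) f < e%:E)%E.

(* The end points of the brackets need not belong to F. *)
Definition covered_by_brackets (P : probability X R) (e : R) F (n : nat) :
    Prop :=
  exists l u : 'I_n -> X -> R,
    (forall i, [/\ measurable_fun setT (l i), measurable_fun setT (u i) &
                   (L2dist P (l i) (u i) < e%:E)%E]) /\
    forall f, F f -> exists i, forall x, l i x <= f x <= u i x.

(* The infimum over the empty set is +oo; otherwise it is a minimum. *)
Definition minimal_number (C : nat -> Prop) : \bar R :=
  ereal_inf [set n%:R%:E | n in [set n | C n]].

Definition entropy_VC F : Prop :=
  exists c0 nu0 : R, [/\ 0 < c0, 0 < nu0 &
    forall (e : R) (Q : probability X R), 0 < e < 1 -> discrete_probability Q ->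
      (minimal_number (covered_by_balls Q e F) <= (c0 / e `^ nu0)%:E)%E].

Definition entropy_BR (P : probability X R) F : Prop :=
  exists b0 r0 : R, [/\ 0 < b0, 0 < r0 < 1 &
    forall e : R, 0 < e < 1 ->
      (minimal_number (covered_by_brackets P e F)
        <= (expR (b0 ^+ 2 / e `^ (2 * r0)))%:E)%E].

Definition uniformly_bounded F : Prop :=
  exists M : R, forall f, F f -> forall x, `|f x| <= M.

Definition pointwise_measurable F : Prop :=
  exists F0 : set (X -> R), [/\ countable F0, F0 `<=` F &
    forall f, F f -> exists g : nat -> X -> R, (forall n, F0 (g n)) /\
      forall x, (fun n => g n x) @ \oo --> f x].

Definition contains_indicators F (m : nat -> nat)
    (A : forall N, 'I_(m N) -> set X) (N1 : nat) : Prop :=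
  forall k, (1 <= k <= N1)%N -> forall j,
    F (\1_(A k j) : X -> R) /\
    forall f, F f -> F (fun x => \1_(A k j) x * f x).

End function_classes.

Section gaussian.
Context (d : measure_display) (W : measurableType d) (R : realType).
Variable Pr : probability W R.

(* [normal_prob] is not a point mass when the standard deviation is 0, whence
   the separate degenerate case. *)
Definition gaussian_variable (Y : W -> R) : Prop :=
  measurable_fun setT Y /\
  ((exists c : R, forall B : set R, measurable B ->
      pushforward Pr Y B = \d_c B) \/
   (exists mu s : R, s != 0 /\ forall B : set R, measurable B ->
      pushforward Pr Y B = normal_prob mu s B)).

Definition gaussian_process (I : Type) (F : set I) (G : I -> W -> R) : Prop :=
  forall (n : nat) (t : 'I_n -> I) (c : 'I_n -> R), (forall i, F (t i)) ->
    gaussian_variable (fun w => \sum_(i < n) c i * G (t i) w).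

Definition covariance_matrix (n : nat) (Y : 'I_n -> W -> R) : 'M[R]_n :=
  \matrix_(i, j) fine (covariance Pr (Y i) (Y j)).

End gaussian.

Definition positive_semidefinite (R : realType) (n : nat) (S : 'M[R]_n) :
    Prop :=
  S^T = S /\ forall v : 'cV[R]_n, 0 <= (v^T *m S *m v) 0 0.

Section bridge.
Context (d : measure_display) (X : measurableType d) (R : realType).
Variable P : probability X R.
Context (d' : measure_display) (W : measurableType d').
Variable Pr : probability W R.

(* Only the values G f for f in F matter.  Linearity is almost sure, for every
   finite linear combination of elements of F that is again in F (its partial
   sums need not be in F). *)
Definition linear_on (F : set (X -> R)) (G : (X -> R) -> W -> R) : Prop :=
  forall (n : nat) (h : 'I_n -> X -> R) (c : 'I_n -> R),
    (forall i, F (h i)) -> F (fun x => \sum_(i < n) c i * h i x) ->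
    {ae Pr, forall w, G (fun x => \sum_(i < n) c i * h i x) w =
                      \sum_(i < n) c i * G (h i) w}.

Definition brownian_bridge (F : set (X -> R)) (G : (X -> R) -> W -> R) : Prop :=
  [/\ gaussian_process Pr F G,
      forall f, F f -> ('E_Pr[G f] = 0)%E,
      linear_on F G &
      forall f g, F f -> F g ->
        covariance Pr (G f) (G g) =
        (\int[P]_x (f x * g x) - (\int[P]_x f x) * (\int[P]_x g x))%:E].

Fixpoint raked (m : nat -> nat) (A : forall N, 'I_(m N) -> set X)
    (G : (X -> R) -> W -> R) (N : nat) : (X -> R) -> W -> R :=
  if N is N'.+1 then
    fun f w => raked A G N' f w -
      \sum_(j < m N'.+1)
        cond_mean P f (A N'.+1 j) * raked A G N' (\1_(A N'.+1 j)) w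
  else G.

End bridge.

(* Main.v *)
Require Import Defs.
From mathcomp Require Import ring zify measurable_realfun.

(* Let [R_k f = f - E(f | A^(k))].  Unfolding the recursion, [G^(N)(f)] is a
   linear combination of coordinates of [G] with the covariances of
   [G (R_1 (... (R_N f)))], so its variance is the variance under [P] of
   [R_1 (... (R_N f))].  Put [n = N1 - N0]: the last [N0] partitions before [N1]
   are the first [N0] ones, hence
   [R_1 ... R_N1 f = R_1 ... R_n (R_1 ... R_N0 f)], and each [R_k] decreases
   the variance under [P], since [R_k f] and [E(f | A^(k))] are uncorrelated.
   The matrix statement is the variance statement for the linear combinations
   of the [f_i]. *)

(** * Mean and covariance of square-integrable functions *)

Section square_integrable.
Context (d : measure_display) (T : measurableType d) (R : realType).
Variable P : probability T R.
Local Notation L2 := (Lfun P 2%:E).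
Implicit Types (f g h : T -> R) (B : set T).

Lemma Lfun2_sqr f : measurable_fun setT f ->
  P.-integrable setT (EFin \o (fun x => f x ^+ 2)) -> f \in L2.
Proof.
move=> mf /integrableP[_ f2]; rewrite inE; apply/andP; split; rewrite inE//=.
rewrite /finite_norm unlock /Lnorm poweR_lty//.
apply: le_lt_trans f2; rewrite le_eqVlt; apply/orP; left; apply/eqP.
apply: eq_integral => x _ /=.
by rewrite normrX powR_mulrn.
Qed.

Lemma bounded_Lfun2 f : measurable_fun setT f ->
  (exists M : R, forall x, `|f x| <= M) -> f \in L2.
Proof.
move=> mf [M fM]; apply: Lfun2_sqr => //.
apply: measurable_bounded_integrable => //.
- by rewrite [ltLHS]probability_setT ltry.
- exact: measurable_funX.
- exists (M ^+ 2); split; first exact: num_real.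
  move=> y My x _; apply: le_trans (ltW My); rewrite normrX.
  by apply: lerXn2r; rewrite ?nnegrE//; apply: le_trans (fM x).
Qed.

(** For a centered [f] the self-covariance is by definition the integral of its square. This brings
    the bridge into L2, where only means and covariances are given. *)
Lemma centered_Lfun2 f : measurable_fun setT f -> ('E_P[f] = 0)%E ->
  (covariance P f f < +oo)%E -> f \in L2.
Proof.
move=> mf Ef; rewrite unlock Ef unlock => f2.
apply: Lfun2_sqr => //; apply/integrableP; split.
  by apply/measurable_EFinP; exact: measurable_funX.
apply: le_lt_trans f2; rewrite le_eqVlt; apply/orP; left; apply/eqP.
apply: eq_integral => x _ /=.
by rewrite !fctE/= subr0 ger0_norm ?sqr_ge0// expr2.
Qed.

Lemma indic_Lfun2 B : measurable B -> (\1_B : T -> R) \in L2.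
Proof.
move=> mB; apply: bounded_Lfun2 => //; exists 1 => x.
by rewrite indicE; case: (x \in B); rewrite ?normr1// normr0.
Qed.

Lemma Lfun2_lin (a : R) f g : f \in L2 -> g \in L2 -> a *: f + g \in L2.
Proof. by have [_] := Lfun_submod_closed P (lee1n 2); apply. Qed.

Lemma Lfun2_sum (I : Type) (s : seq I) (c : I -> R) (f : I -> T -> R) :
  (forall i, f i \in L2) -> \sum_(i <- s) c i *: f i \in L2.
Proof.
move=> fi; elim: s => [|i s IH]; last by rewrite big_cons Lfun2_lin.
by rewrite big_nil; have [] := Lfun_submod_closed P (lee1n 2).
Qed.

Lemma Lfun2_Lfun1 f : f \in L2 -> f \in Lfun P 1.
Proof.
have Pfin : P setT \is a fin_num := fin_num_measure P _ measurableT.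
exact: (Lfun_subset12 Pfin).
Qed.

Lemma Lfun2_mul f g : f \in L2 -> g \in L2 -> f * g \in Lfun P 1.
Proof. exact: Lfun2_mul_Lfun1. Qed.

Definition mean f : R := \int[P]_x f x.

Lemma meanE f : mean f = fine 'E_P[f].
Proof. by rewrite unlock. Qed.

Lemma mean_lin (a : R) f g : f \in Lfun P 1 -> g \in Lfun P 1 ->
  mean (a *: f + g) = a * mean f + mean g.
Proof.
move=> /Lfun1_integrable fi /Lfun1_integrable gi.
rewrite /mean RintegralD//=; last first.
  by apply/Lfun1_integrable; apply: rpredZ; exact/Lfun1_integrable.
by rewrite RintegralZl.
Qed.

Lemma mean_sum (I : Type) (s : seq I) (c : I -> R) (f : I -> T -> R) :
  (forall i, f i \in Lfun P 1) ->
  mean (\sum_(i <- s) c i *: f i) = \sum_(i <- s) c i * mean (f i).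
Proof.
move=> fi; elim: s => [|i s IH].
  by rewrite !big_nil /mean Rintegral_cst// mul0r.
rewrite !big_cons mean_lin ?IH//.
by apply: rpred_sum => j _; exact: rpredZ.
Qed.

Lemma mean_indic B : measurable B -> mean \1_B = fine (P B).
Proof. by move=> mB; rewrite meanE expectation_indic. Qed.

(** [fine] sends infinite values to 0; between square-integrable functions the covariance is finite,
    so nothing is lost there. *)
Definition cov f g : R := fine (covariance P f g).

Lemma covarianceEFin f g : f \in L2 -> g \in L2 ->
  covariance P f g = (cov f g)%:E.
Proof.
move=> f2 g2; rewrite fineK//; apply: covariance_fin_num.
- exact: Lfun2_Lfun1.
- exact: Lfun2_Lfun1.
- exact: Lfun2_mul.
Qed.

Lemma covE f g : f \in L2 -> g \in L2 ->
  cov f g = mean (f * g) - mean f * mean g.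
Proof.
move=> f2 g2; have [f1 g1] := (Lfun2_Lfun1 f2, Lfun2_Lfun1 g2).
have fg1 := Lfun2_mul f2 g2.
rewrite /cov covarianceE// fineB ?fin_numM ?expectation_fin_num//.
by rewrite fineM ?expectation_fin_num// !meanE.
Qed.

Lemma covC f g : cov f g = cov g f.
Proof. by rewrite /cov covarianceC. Qed.

Lemma cov_linl (a : R) f g h : f \in L2 -> g \in L2 -> h \in L2 ->
  cov (a *: f + g) h = a * cov f h + cov g h.
Proof.
move=> f2 g2 h2.
have afg := Lfun2_lin a f2 g2.
have e : (a *: f + g) * h = a *: (f * h) + g * h.
  by apply/funext => x; rewrite !fctE mulrDl -mulrA.
rewrite !covE// e !mean_lin ?Lfun2_mul ?Lfun2_Lfun1//.
ring.
Qed.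

Lemma cov0l h : cov 0 h = 0.
Proof. by rewrite /cov (covariance_cst_l P 0). Qed.

Lemma cov_suml (I : Type) (s : seq I) (c : I -> R) (f : I -> T -> R) h :
  (forall i, f i \in L2) -> h \in L2 ->
  cov (\sum_(i <- s) c i *: f i) h = \sum_(i <- s) c i * cov (f i) h.
Proof.
move=> fi h2; elim: s => [|i s IH]; first by rewrite !big_nil cov0l.
by rewrite !big_cons cov_linl ?IH// Lfun2_sum.
Qed.

Lemma cov_sum (n : nat) (c : 'I_n -> R) (f : 'I_n -> T -> R) :
  (forall i, f i \in L2) ->
  cov (\sum_i c i *: f i) (\sum_i c i *: f i) =
  \sum_i \sum_j c i * c j * cov (f i) (f j).
Proof.
move=> fi; have f2 := Lfun2_sum (index_enum 'I_n) c fi.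
rewrite cov_suml//; apply: eq_bigr => i _; rewrite covC cov_suml// mulr_sumr.
by apply: eq_bigr => j _; rewrite (covC (f i)) mulrA.
Qed.

Lemma covD f g : f \in L2 -> g \in L2 ->
  cov (f + g) (f + g) = cov f f + cov g g + 2 * cov f g.
Proof.
move=> f2 g2; have fg2 := Lfun2_lin 1 f2 g2.
rewrite -{1 2}[f]scale1r cov_linl// !(covC _ (_ + _)) !cov_linl//.
by rewrite (covC g f); ring.
Qed.

Lemma cov_ge0 f : 0 <= cov f f.
Proof. by rewrite fine_ge0//; exact: variance_ge0. Qed.

End square_integrable.

(** * Conditional expectation given one partition, and its residual *)

Section residual.
Context (d : measure_display) (X : measurableType d) (R : realType).
Variable P : probability X R.
Local Notation L2 := (Lfun P 2%:E).
Implicit Types (f g : X -> R).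

(** The conditional expectation of [f] given the sigma-algebra generated by the cells. *)
Definition cell_average (n : nat) (B : 'I_n -> set X) f : X -> R :=
  \sum_j cond_mean P f (B j) *: (\1_(B j) : X -> R).

Definition residual (n : nat) (B : 'I_n -> set X) f : X -> R :=
  f - cell_average B f.

Definition positive_partition (n : nat) (B : 'I_n -> set X) : Prop :=
  partition setT B setT /\ forall j, measurable (B j) /\ (0 < P (B j))%E.

Lemma cond_mean_lin (a : R) f g (B : set X) : measurable B ->
  f \in L2 -> g \in L2 ->
  cond_mean P (a *: f + g) B = a * cond_mean P f B + cond_mean P g B.
Proof.
move=> mB f2 g2; rewrite /cond_mean.
have B2 := indic_Lfun2 P mB.
have := mean_lin a (Lfun2_mul f2 B2) (Lfun2_mul g2 B2).
have -> : a *: (f * \1_B) + g * \1_B = (a *: f + g) * \1_B.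
  by apply/funext => x; rewrite !fctE mulrDl -mulrA.
rewrite /mean /= => ->; ring.
Qed.

Section one_partition.
Variables (n : nat) (B : 'I_n -> set X).
Hypothesis hB : positive_partition B.
Let mB j : measurable (B j) := (hB.2 j).1.
Let p j : R := fine (P (B j)).

Let p_neq0 j : p j != 0.
Proof.
rewrite gt_eqF// fine_gt0// (hB.2 j).2/= (le_lt_trans (probability_le1 _ _))//.
by rewrite ltry.
Qed.

Lemma cell_indic i j x : B j x -> \1_(B i) x = (i == j)%:R :> R.
Proof.
move=> Bjx; rewrite indicE; case: eqP => [->|ij]; first by rewrite mem_set.
rewrite memNset// => Bix; apply: ij; have [_ tB _] := hB.1.
by apply: tB => //; exists x.
Qed.

Lemma in_cell x : exists j, B j x.
Proof.
have [cB _ _] := hB.1; have : [set: X] x by [].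
by rewrite -cB => -[j _ ?]; exists j.
Qed.

Lemma cell_averageE f j x : B j x -> cell_average B f x = cond_mean P f (B j).
Proof.
move=> Bjx; rewrite /cell_average fct_sumE (bigD1 j)//= big1 => [|i ij].
  by rewrite !fctE (cell_indic _ Bjx) eqxx addr0 /GRing.scale/= mulr1.
by rewrite !fctE (cell_indic _ Bjx) (negPf ij) /GRing.scale/= mulr0.
Qed.

Lemma cell_average_Lfun2 f : cell_average B f \in L2.
Proof. by apply: Lfun2_sum => j; exact: indic_Lfun2. Qed.

Lemma residualE f : residual B f = -1 *: cell_average B f + f.
Proof. by rewrite scaleN1r addrC. Qed.

Lemma residual_Lfun2 f : f \in L2 -> residual B f \in L2.
Proof. by move=> f2; rewrite residualE Lfun2_lin// cell_average_Lfun2. Qed.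

Lemma residual_lin (a : R) f g : f \in L2 -> g \in L2 ->
  residual B (a *: f + g) = a *: residual B f + residual B g.
Proof.
move=> f2 g2; rewrite /residual scalerBr addrACA -opprD; congr (_ - _).
rewrite /cell_average scaler_sumr -big_split/=; apply: eq_bigr => j _.
by rewrite cond_mean_lin// scalerDl scalerA.
Qed.

(** Law of total expectation: the indicators of the cells sum to 1. *)
Lemma mean_cells f : f \in L2 -> mean P f = \sum_j cond_mean P f (B j) * p j.
Proof.
move=> f2.
have {1}-> : f = \sum_j 1 *: (f * \1_(B j)).
  apply/funext => x; rewrite fct_sumE; have [j Bjx] := in_cell x.
  rewrite (bigD1 j)//= big1 => [|i ij].
    by rewrite !fctE (cell_indic _ Bjx) eqxx addr0 mulr1 scale1r.
  by rewrite !fctE (cell_indic _ Bjx) (negPf ij) mulr0 scaler0.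
rewrite mean_sum => [|j]; last by apply: Lfun2_mul f2 _; exact: indic_Lfun2.
by apply: eq_bigr => j _; rewrite mul1r /cond_mean -/(p j) divfK.
Qed.

Lemma cov_indic f j : f \in L2 ->
  cov P f \1_(B j) = (cond_mean P f (B j) - mean P f) * p j.
Proof.
move=> f2; rewrite covE ?indic_Lfun2// mean_indic// mulrBl; congr (_ - _).
by rewrite /cond_mean -/(p j) divfK.
Qed.

Lemma cond_mean_indic i j : cond_mean P \1_(B i) (B j) = (i == j)%:R :> R.
Proof.
rewrite /cond_mean -/(p j).
rewrite -/(mean P (\1_(B i) * \1_(B j))).
apply: (mulIf (p_neq0 j)); rewrite divfK//.
case: (eqVneq i j) => [->|ij]; rewrite ?mul1r ?mul0r.
  by rewrite /p -mean_indic//; congr mean; apply/funext => x;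
    rewrite fctE !indicE; case: (x \in _); rewrite ?mulr1 ?mulr0.
rewrite (_ : _ * _ = cst 0) /mean ?Rintegral_cst ?mul0r//.
apply/funext => x; rewrite fctE/=; case: (pselect (B j x)) => Bjx.
  by rewrite (cell_indic _ Bjx) (negPf ij) mul0r.
by rewrite [X in _ * X]indicE memNset// mulr0.
Qed.

(** Averaging over cells preserves the integral over each cell, hence also the covariance with its
    indicator. *)
Lemma cov_residual_indic f j : f \in L2 -> cov P (residual B f) \1_(B j) = 0.
Proof.
move=> f2; have i2 i : (\1_(B i) : X -> R) \in L2 by exact: indic_Lfun2.
rewrite residualE cov_linl ?cell_average_Lfun2//.
rewrite cov_suml// cov_indic//.
under eq_bigr do rewrite cov_indic// cond_mean_indic mean_indic// mulrBl mulrBr.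
(* With [c i] the mean of [f] on cell [i], the sum of [c i * ((i == j) - p i) * p j] is split: the
   first part leaves [c j * p j], the second is [mean P f * p j] by total expectation. *)
rewrite big_split/= (bigD1 j)//= eqxx big1 => [|i /negPf ->]; last first.
  by rewrite mul0r mulr0.
rewrite mulr1n sumrN [X in _ - X](_ : _ = mean P f * p j); first by ring.
by rewrite (mean_cells f2) mulr_suml; apply: eq_bigr => i _; rewrite mulrA.
Qed.

Lemma cov_residual_average f g : f \in L2 ->
  cov P (residual B f) (cell_average B g) = 0.
Proof.
move=> f2; have r2 := residual_Lfun2 f2.
rewrite covC cov_suml// => [|j]; last exact: indic_Lfun2.
by rewrite big1// => j _; rewrite covC cov_residual_indic// mulr0.
Qed.

(** Pythagoras: [f] is the sum of its residual and its cell average, which are uncorrelated, and the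
    average has nonnegative variance. *)
Lemma cov_residual_le f : f \in L2 ->
  cov P (residual B f) (residual B f) <= cov P f f.
Proof.
move=> f2; have e : f = residual B f + cell_average B f by rewrite subrK.
rewrite {3 4}e covD ?residual_Lfun2 ?cell_average_Lfun2//.
by rewrite cov_residual_average// mulr0 addr0 lerDl cov_ge0.
Qed.

End one_partition.

(** The cell average at [x] depends only on the cell containing [x], not on how the cells are
    numbered. *)
Lemma residual_range (n n' : nat) (B : 'I_n -> set X) (B' : 'I_n' -> set X) f :
  positive_partition B -> positive_partition B' -> range B = range B' ->
  residual B f = residual B' f.
Proof.
move=> hB hB' e; congr (_ - _); apply/funext => x.
have [j Bjx] := in_cell hB x.
have [i _ Bi] : range B' (B j) by rewrite -e; exists j.
rewrite (cell_averageE hB _ Bjx); rewrite -Bi in Bjx *.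
by rewrite (cell_averageE hB' _ Bjx).
Qed.

End residual.

(** * Iterated residuals *)

Section raking.
Context (d : measure_display) (X : measurableType d) (R : realType).
Variable P : probability X R.
Variables (m : nat -> nat) (A : forall N, 'I_(m N) -> set X).
Local Notation L2 := (Lfun P 2%:E).
Implicit Types (f g : X -> R).

(** The last partition acts first: by formal linearity, a raking step evaluates the previous process
    at the residual of [f]. *)
Fixpoint residuals (N : nat) f : X -> R :=
  if N is N'.+1 then residuals N' (residual P (@A N'.+1) f) else f.

Hypothesis hA : forall N, (1 <= N)%N -> positive_partition P (@A N).

Lemma residuals_Lfun2 N f : f \in L2 -> residuals N f \in L2.
Proof.
by elim: N f => //= N IH f f2; apply/IH/residual_Lfun2 => //; exact: hA.
Qed.

Lemma residuals_lin N (a : R) f g : f \in L2 -> g \in L2 ->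
  residuals N (a *: f + g) = a *: residuals N f + residuals N g.
Proof.
elim: N f g => //= N IH f g f2 g2; have hN := hA (ltn0Sn N).
by rewrite (residual_lin hN)// IH// residual_Lfun2.
Qed.

Lemma residuals_sum N (I : Type) (s : seq I) (c : I -> R) (f : I -> X -> R) :
  (forall i, f i \in L2) ->
  residuals N (\sum_(i <- s) c i *: f i) =
  \sum_(i <- s) c i *: residuals N (f i).
Proof.
move=> fi; elim: s => [|i s IH]; last first.
  by rewrite !big_cons residuals_lin// ?IH// Lfun2_sum.
(* The empty sum puts 0 in L2; then linearity with coefficient -1 at 0 shows that [residuals N]
   fixes 0. *)
have z2 := Lfun2_sum [::] (fun=> 0) fi.
rewrite !big_nil in z2 *.
by have := residuals_lin N (-1) z2 z2; rewrite !scaleN1r !addNr.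
Qed.

Lemma cov_residuals_le N f : f \in L2 ->
  cov P (residuals N f) (residuals N f) <= cov P f f.
Proof.
elim: N f => //= N IH f f2; have hN := hA (ltn0Sn N).
by apply: le_trans (IH _ _) _; rewrite ?residual_Lfun2// cov_residual_le.
Qed.

(** The partitions after [N1 - N0] repeat the first [N0] in order, so the residuals acting first on
    [f] coincide. The induction generalizes [f], since each step replaces it by a residual. *)
Lemma residuals_suffix (N0 N1 n : nat) f : (N0 <= N1)%N ->
  (forall k, (k < N0)%N -> range (@A (N0 - k)%N) = range (@A (N1 - k)%N)) ->
  (n <= N0)%N ->
  residuals (N1 - N0 + n) f = residuals (N1 - N0) (residuals n f).
Proof.
move=> N01 hAN; elim: n f => [|n IH] f nN0; first by rewrite addn0.
rewrite addnS /= -IH 1?ltnW//; congr (residuals _ _).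
apply: residual_range; [exact: hA..|].
(* This choice of [k] gives [N0 - k = n + 1] and [N1 - k = N1 - N0 + n + 1]. *)
have := hAN (N0 - n.+1)%N; rewrite subKn// => ->; last by lia.
by rewrite (_ : N1 - (N0 - n.+1) = (N1 - N0 + n).+1)%N; last by lia.
Qed.

Lemma cov_residuals_le_suffix (N0 N1 : nat) f : (N0 <= N1)%N ->
  (forall k, (k < N0)%N -> range (@A (N0 - k)%N) = range (@A (N1 - k)%N)) ->
  f \in L2 ->
  cov P (residuals N1 f) (residuals N1 f) <=
  cov P (residuals N0 f) (residuals N0 f).
Proof.
move=> N01 hAN f2; have := residuals_suffix f N01 hAN (leqnn N0).
by rewrite subnK// => ->; rewrite cov_residuals_le// residuals_Lfun2.
Qed.

(** * Transfer of covariances from the process to functions under [P] *)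

Context (d' : measure_display) (W : measurableType d').
Variables (Pr : probability W R) (F : set (X -> R)) (G : (X -> R) -> W -> R).

(* [Y] stands for [G h]: it is the combination of coordinates of [G] matching
   one that represents [h], which may itself lie outside [F]. *)
Inductive linked : (W -> R) -> (X -> R) -> Prop :=
| linked_coord f : F f -> linked (G f) f
| linked_lin (a : R) Y h Y' h' :
    linked Y h -> linked Y' h' -> linked (a *: Y + Y') (a *: h + h').

Lemma linked_sum n (c : 'I_n -> R) Y h (Y' : 'I_n -> W -> R)
    (h' : 'I_n -> X -> R) (r : seq 'I_n) :
  linked Y h -> (forall i, linked (Y' i) (h' i)) ->
  linked (Y - \sum_(i <- r) c i *: Y' i) (h - \sum_(i <- r) c i *: h' i).
Proof.
move=> Yh Yh'; elim: r => [|i r IH]; first by rewrite !big_nil !subr0.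
rewrite !big_cons !opprD !(addrCA Y) !(addrCA h) -!scaleNr.
exact: linked_lin.
Qed.

Hypothesis F_Lfun2 : forall f, F f -> f \in L2.
Hypothesis G_Lfun2 : forall f, F f -> G f \in Lfun Pr 2%:E.
Hypothesis G_cov : forall f g, F f -> F g ->
  cov Pr (G f) (G g) = cov P f g.

Lemma linked_Lfun2 Y h : linked Y h -> Y \in Lfun Pr 2%:E /\ h \in L2.
Proof.
elim=> [f Ff|a Y1 h1 Y2 h2 _ [Y12 h12] _ [Y22 h22]].
  by split; [exact: G_Lfun2|exact: F_Lfun2].
by split; exact: Lfun2_lin.
Qed.

(** Both covariances are bilinear and agree on coordinates, so a nested induction on the two
    derivations suffices. *)
Lemma linked_cov Y h Y' h' : linked Y h -> linked Y' h' ->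
  cov Pr Y Y' = cov P h h'.
Proof.
move=> Yh Yh'; elim: Yh => [f Ff|a Y1 h1 Y2 h2 Yh1 IH1 Yh2 IH2].
  have [Gf2 f2] := (G_Lfun2 Ff, F_Lfun2 Ff).
  elim: Yh' => [g Fg|a Y1 h1 Y2 h2 Yh1 IH1 Yh2 IH2]; first exact: G_cov.
  have [[Y12 h12] [Y22 h22]] := (linked_Lfun2 Yh1, linked_Lfun2 Yh2).
  rewrite covC cov_linl// (covC _ f) cov_linl//.
  by rewrite !(covC _ _ (G f)) !(covC _ _ f) IH1 IH2.
have [[Y12 h12] [Y22 h22]] := (linked_Lfun2 Yh1, linked_Lfun2 Yh2).
have [Y'2 h'2] := linked_Lfun2 Yh'.
by rewrite !cov_linl// IH1 IH2.
Qed.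

(** [residuals N] is linear, so the residual of [f] expands with the very coefficients of the raking
    recursion. The recursion evaluates the process only at [f] and at indicators of cells, all in
    [F]. *)
Lemma linked_raked N f :
  (forall k, (1 <= k <= N)%N -> forall j, F (\1_(@A k j) : X -> R)) ->
  F f -> linked (raked P A G N f) (residuals N f).
Proof.
elim: N f => [|N IH] f F1 Ff /=; first exact: linked_coord.
have IHN g : F g -> linked (raked P A G N g) (residuals N g).
  by apply: IH => k kN; apply: F1; lia.
have F1N j : F (\1_(@A N.+1 j) : X -> R) by apply: F1; rewrite ltnS leqnn.
have -> : residuals N (residual P (@A N.+1) f) = residuals N f -
    \sum_j cond_mean P f (@A N.+1 j) *: residuals N \1_(@A N.+1 j).
  rewrite -residuals_sum => [|j]; last exact: F_Lfun2.
  rewrite residualE residuals_lin ?scaleN1r 1?addrC//; last exact: F_Lfun2.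
  by apply: Lfun2_sum => j; exact: F_Lfun2.
pose c j := cond_mean P f (@A N.+1 j).
have := linked_sum c (index_enum _) (IHN _ Ff) (fun j => IHN _ (F1N j)).
congr linked; apply/funext => w; rewrite !fctE fct_sumE.
by congr (_ - _).
Qed.

End raking.

(** * Comparison of variances and covariance matrices *)

Lemma quadratic_form (R : realType) (n : nat) (S : 'M[R]_n) (v : 'cV[R]_n) :
  (v^T *m S *m v) 0 0 = \sum_i \sum_j v i 0 * v j 0 * S i j.
Proof.
rewrite mxE exchange_big/=; apply: eq_bigr => j _.
rewrite mxE mulr_suml; apply: eq_bigr => i _.
by rewrite mxE mulrAC.
Qed.

Theorem proposition9
  (R : realType)
  (d : measure_display) (X : measurableType d) (P : probability X R)
  (m : nat -> nat) (A : forall N, 'I_(m N) -> set X)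
  (hA : partition_sequence P A)
  (N0 N1 : nat)
  (F : set (X -> R))
  (F_meas : forall f, F f -> measurable_fun setT f)
  (F_bounded : uniformly_bounded F)
  (F_ptmeas : pointwise_measurable F)
  (F_indic : contains_indicators F A N1)
  (F_entropy : entropy_VC F \/ entropy_BR P F)
  (d' : measure_display) (W : measurableType d') (Pr : probability W R)
  (G : (X -> R) -> W -> R)
  (hG : brownian_bridge P Pr F G)
  (hN : (2 * N0 <= N1)%N)
  (hAN : forall k, (k < N0)%N -> range (A (N0 - k)%N) = range (A (N1 - k)%N)) :
  (forall f, F f ->
     ('V_Pr[raked P A G N1 f] <= 'V_Pr[raked P A G N0 f])%E) /\
  (forall (n : nat) (f : 'I_n -> X -> R), (forall i, F (f i)) ->
     positive_semidefinite
       (covariance_matrix Pr (fun i => raked P A G N0 (f i)) -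
        covariance_matrix Pr (fun i => raked P A G N1 (f i)))).
Proof.
have hP N : (1 <= N)%N -> positive_partition P (A N).
  by move=> N1'; have [_ ? ?] := hA.1 N N1'.
have N01 : (N0 <= N1)%N by lia.
have [M FM] := F_bounded.
have F2 f : F f -> f \in Lfun P 2%:E.
  move=> Ff; apply: bounded_Lfun2; first exact: F_meas.
  by exists M; exact: FM.
have [G_gauss G_mean _ G_cov] := hG.
have G2 f : F f -> G f \in Lfun Pr 2%:E.
  move=> Ff; apply: centered_Lfun2; [|exact: G_mean|by rewrite G_cov// ltry].
  (* The one-term combination with coefficient 1 is [G f]; a Gaussian variable is measurable. *)
  have [] := G_gauss 1%N (fun=> f) (fun=> 1) (fun=> Ff).
  by under eq_fun do rewrite big_ord1 mul1r.
have Gc f g : F f -> F g -> cov Pr (G f) (G g) = cov P f g.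
  by move=> Ff Fg; rewrite (covE (F2 _ Ff) (F2 _ Fg)) /cov G_cov.
have link N f : (N <= N1)%N -> F f ->
    linked F G (raked P A G N f) (residuals P A N f).
  move=> NN1; apply: (linked_raked hP) => // k kN j.
  by have [] := F_indic k _ j; first by lia.
have raked_cov N f g : (N <= N1)%N -> F f -> F g ->
    cov Pr (raked P A G N f) (raked P A G N g) =
    cov P (residuals P A N f) (residuals P A N g).
  by move=> NN1 Ff Fg; apply: (linked_cov F2 G2 Gc); exact: link.
split=> [f Ff|n f Ff].
  have R2 N : (N <= N1)%N -> raked P A G N f \in Lfun Pr 2%:E.
    by move=> NN1; have [] := linked_Lfun2 F2 G2 (link N f NN1 Ff).
  rewrite /variance !covarianceEFin ?R2// lee_fin !raked_cov//.
  by apply: cov_residuals_le_suffix => //; exact: F2.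
split=> [|v].
  apply/matrixP => i j; rewrite !mxE.
  by congr (fine _ - fine _); exact: covarianceC.
(* The quadratic form at [v] is a variance under [P], that of the iterated residual of the
   combination of the [f i] with weights [v]. The combination may leave [F] but stays in L2, where
   the variance inequality holds. *)
have form N : (N <= N1)%N ->
    \sum_i \sum_j v i 0 * v j 0 *
      covariance_matrix Pr (fun i => raked P A G N (f i)) i j =
    cov P (residuals P A N (\sum_i v i 0 *: f i))
          (residuals P A N (\sum_i v i 0 *: f i)).
  move=> NN1; have f2 i := F2 _ (Ff i).
  rewrite (residuals_sum hP)// cov_sum => [|i]; last first.
    exact: (residuals_Lfun2 hP).
  apply: eq_bigr => i _; apply: eq_bigr => j _.
  by rewrite mxE -/(cov _ _ _) raked_cov.
rewrite mulmxBr mulmxBl mxE [X in _ + X]mxE !quadratic_form !form// subr_ge0.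
by apply: cov_residuals_le_suffix => //; apply: Lfun2_sum => i; exact: F2.
Qed.
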